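(* Assume $\omega_a\neq0$ and $\omega_{-b}\neq0$. Then, as formal power series in $z$ over $K$, $$\sum_{k\ge0}F_k z^k=\frac{N(z)}{D(z)},$$ where $D(z)=\det(1-z\mathbf T)$ and $N(z)$ is the $(I_0,I_0)$ cofactor of $1-z\mathbf T$ (the determinant of $1-z\mathbf T$ with row $I_0$ and column $I_0$ deleted), $I_0=[0,a-1]$. Moreover $D(z)$ has degree exactly $\binom{a+b}{a}$ and $N(z)$ has degree exactly $\binom{a+b}{a}-a-b$.
   Context: Let $S$ be a finite set of integers with $a:=\max S\ge 1$ and $b:=-\min S\ge 1$. Each $s\in S$ carries a weight $\omega_s$ in a field $K$ of characteristic $0$; set $\omega_s:=0$ for $s\in\mathbb Z\setminus S$, and for $s\in\mathbb Z$ put $\beta_s:=\delta_{s,0}-\omega_s$. For $k\ge0$, $A_k$ is the $(k+1)\times(k+1)$ matrix with rows and columns indexed by $0,\dots,k$ whose $(i,j)$ entry is $\omega_{j-i}$. Put $F_0:=1$ and $F_k:=\det(1-A_{k-1})$ for $k\ge1$. Notation: $[m,n]:=\{i\in\mathbb Z: m\le i\le n\}$, $X+c:=\{x+c:x\in X\}$; an $n$-subset is a subset of cardinality $n$. For a finite set $I\subseteq\mathbb Z$ and $s\in\mathbb Z$, $\epsilon_s(I):=(-1)^{\#\{i\in I:\ i<s\}}$. $\mathbf T$ is the square matrix with rows and columns indexed by the $a$-subsets of $[-b,a-1]$ and entries $\mathbf T[I,J]:=\epsilon_s(I)\beta_s$ if there is an integer $s$ with $I\cup\{a\}=(J+1)\cup\{s\}$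 (such $s$ is then unique), and $\mathbf T[I,J]:=0$ otherwise. *)

(* Defs.v *)
From HB Require Import structures.
From mathcomp Require Import all_boot all_order all_algebra.
Set Implicit Arguments. Unset Strict Implicit. Unset Printing Implicit Defensive.
Import Order.TTheory GRing.Theory Num.Theory.
Local Open Scope ring_scope.

Definition Amx (K : fieldType) (w : int -> K) (k : nat) : 'M[K]_k.+1 :=
  \matrix_(i < k.+1, j < k.+1) w (Posz j - Posz i).

Definition Fk (K : fieldType) (w : int -> K) (k : nat) : K :=
  match k with
  | 0 => 1
  | k'.+1 => \det (1%:M - Amx w k')
  end.

(* Encoding of the integer window [-b, a]: the ordinal x : 'I_(a+b).+1
   stands for the integer x - b.  ord_max stands for a. *)
Definition zval (b : nat) (n : nat) (x : 'I_n) : int := Posz x - Posz b.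

(* a-subsets of [-b, a-1]: subsets of the window of size a avoiding a. *)
Definition is_asub (a b : nat) (X : {set 'I_(a+b).+1}) : bool :=
  (#|X| == a) && (ord_max \notin X).
Arguments is_asub : clear implicits.

Definition asub (a b : nat) := {X : {set 'I_(a+b).+1} | is_asub a b X}.

Definition shift1 (a b : nat) (X : {set 'I_(a+b).+1}) : {set 'I_(a+b).+1} :=
  [set (inord (nat_of_ord j).+1 : 'I_(a+b).+1) | j in X].

Definition beta (K : fieldType) (w : int -> K) (s : int) : K :=
  (s == 0)%:R - w s.

Definition eps (K : fieldType) (n : nat) (I : {set 'I_n}) (s : 'I_n) : K :=
  (-1) ^+ #|[set i in I | (i < s)%N]|.

(* T[I,J] = eps_s(I) beta_s if I u {a} = (J+1) u {s} for some integer s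
   (any such s lies in I u {a}, hence in the window [-b,a]), else 0. *)
Definition Tentry (K : fieldType) (w : int -> K) (a b : nat) (I J : asub a b) : K :=
  match [pick s : 'I_(a+b).+1 | val I :|: [set ord_max] == shift1 (val J) :|: [set s]] with
  | Some s => eps K (val I) s * beta w (zval b s)
  | None => 0
  end.

Definition Tmx (K : fieldType) (w : int -> K) (a b : nat) : 'M[K]_#|{: asub a b}| :=
  \matrix_(i, j) Tentry w (enum_val i) (enum_val j).

Definition Mz (K : fieldType) (w : int -> K) (a b : nat) : 'M[{poly K}]_#|{: asub a b}| :=
  1%:M - 'X *: map_mx polyC (Tmx w a b).

Definition Dpoly (K : fieldType) (w : int -> K) (a b : nat) : {poly K} :=
  \det (Mz w a b).

(* I_0 = [0, a-1], i.e. ordinals b .. a+b-1. *)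
Definition I0set (a b : nat) : {set 'I_(a+b).+1} :=
  [set x : 'I_(a+b).+1 | (b <= x < a + b)%N].

Lemma I0set_asub (a b : nat) : is_asub a b (I0set a b).
Proof.
rewrite /is_asub /I0set; apply/andP; split.
  rewrite cardsE.
  have -> : #|[pred x : 'I_(a+b).+1 | (b <= x < a + b)%N]|
      = count (fun x => (b <= x < a + b)%N) (iota 0 (a+b).+1).
    by rewrite cardE size_filter -val_enum_ord count_map -enumT; apply: eq_count.
  rewrite -addn1 iotaD add0n count_cat /= ltnn andbF addn0.
  rewrite [(a + b)%N]addnC iotaD count_cat add0n.
  have -> : count (fun x => (b <= x < b + a)%N) (iota 0 b) = 0%N.
    apply/eqP; rewrite -leqn0 leqNgt -has_count; apply/hasP=> -[x].
    rewrite mem_iota add0n => /andP[_ H] /andP[Hb _]; by move: (leq_trans H Hb); rewrite ltnn.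
  rewrite add0n (eq_in_count (a2 := predT)) ?count_predT ?size_iota ?addn0 // => x.
  by rewrite mem_iota => ->.
by rewrite inE /= ltnn andbF.
Qed.

Definition I0 (a b : nat) : asub a b := exist _ (I0set a b) (I0set_asub a b).

Definition Npoly (K : fieldType) (w : int -> K) (a b : nat) : {poly K} :=
  \det (row' (enum_rank (I0 a b)) (col' (enum_rank (I0 a b)) (Mz w a b))).

(* Main.v *)
Require Import Defs.
From HB Require Import structures.
From mathcomp Require Import all_boot all_order all_algebra.
From mathcomp Require Import zify.
Import Order.TTheory GRing.Theory Num.Theory.
Local Open Scope ring_scope.

(* Let c = (-1)^a beta_a and let u be a sequence of vectors of K^a satisfying the
   recurrence sum_x beta_(x-b) u(m+x) = 0.  Its Pluecker vector
   (det of the rows u(i), i in I)_I is mapped by T to c times the Pluecker vector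
   of the shifted sequence: this is a cofactor expansion along the row s.  Every
   basis vector e_I is the Pluecker vector of such a sequence, and since beta_(-b)
   is nonzero sequences extend backwards; hence T is invertible, and D has full
   degree.  For the sequence u that starts as b zeros followed by the identity,
   (T^k)[I_0,I_0] is c^k times the minor of u on rows k+b, .., k+b+a-1, which is
   F_k by the relation between complementary minors of the banded matrix
   (beta_(j-i)) and of a basis of its kernel.  Comparing coefficients in
   adj(1-zT) (1-zT) = D gives the first claim.  At infinity, N/D expands as
   - sum_(k>=1) (T^-k)[I_0,I_0] z^-k, where (T^-k)[I_0,I_0] is a minor of the
   backward extension of u: it has a zero row for k < a+b, while for k = a+b its
   vanishing would yield a nonzero scalar solution with a+b consecutive zeros. *)

Set Implicit Arguments.
Unset Strict Implicit.
Unset Printing Implicit Defensive.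

(** * Determinants formed from chosen rows of a sequence of vectors *)

Definition seqdet (K : fieldType) (m : nat) (u : nat -> 'rV[K]_m) (s : seq nat) : K :=
  \det (\matrix_(i < m, j < m) u (nth 0%N s i) 0 j).

(** The sign omits the position of the removed row, so the value depends only on the rows [t] that
    remain. *)
Definition seqcof (K : fieldType) (m : nat) (u : nat -> 'rV[K]_m.+1)
    (t : seq nat) (j : 'I_m.+1) : K :=
  (-1) ^+ j * \det (\matrix_(i < m, k < m) u (nth 0%N t i) 0 (lift j k)).

Lemma seqdet_expand (K : fieldType) (m : nat) (u : nat -> 'rV[K]_m.+1) s1 x s2 :
  (size s1 <= m)%N ->
  seqdet u (s1 ++ x :: s2)
    = (-1) ^+ size s1 * \sum_j u x 0 j * seqcof u (s1 ++ s2) j.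
Proof.
move=> s1m; have s1m' : (size s1 < m.+1)%N by rewrite ltnS.
rewrite /seqdet (expand_det_row _ (Ordinal s1m')) mulr_sumr; apply: eq_bigr => j _.
rewrite mxE /= nth_cat ltnn subnn /= /cofactor /seqcof /= exprD -!mulrA mulrCA.
congr (_ * (_ * (_ * \det _))); apply/matrixP => i k.
rewrite !mxE /= /bump !nth_cat; case: (leqP (size s1) i) => [le|lt] /=.
  by rewrite add1n ltnNge (leqW le) /= subSn.
by rewrite add0n lt.
Qed.

(** Both sides expand along the row [x] with the same cofactors, those of [s1 ++ s2]. *)
Lemma seqdet_move (K : fieldType) (m : nat) (u : nat -> 'rV[K]_m.+1) s1 x s2 :
  (size s1 <= m)%N ->
  seqdet u (s1 ++ x :: s2) = (-1) ^+ size s1 * seqdet u (x :: s1 ++ s2).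
Proof.
move=> s1m; rewrite (seqdet_expand u x s2 s1m).
by rewrite -[x :: _]/([::] ++ x :: (s1 ++ s2)) seqdet_expand // expr0 mul1r.
Qed.

Lemma seqdet_dup (K : fieldType) (m : nat) (u : nat -> 'rV[K]_m.+1) x t :
  size t = m -> x \in t -> seqdet u (x :: t) = 0.
Proof.
move=> szt xt; have lti : ((index x t).+1 < m.+1)%N by rewrite ltnS -szt index_mem.
apply: (@determinant_alternate _ _ _ ord0 (Ordinal lti)) => // j.
by rewrite !mxE /= nth_index.
Qed.

(** Expansion along the first row makes the determinant linear in it, with cofactors depending on
    [t] alone. *)
Lemma seqdet_lin (K : fieldType) (m n : nat) (u : nat -> 'rV[K]_m.+1) (B : nat -> K) t :
  \sum_(x < n) B x *: u x = 0 -> \sum_(x < n) B x * seqdet u (nat_of_ord x :: t) = 0.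
Proof.
move=> Bu0.
transitivity (\sum_j (\sum_(x < n) B x *: u x) 0 j * seqcof u t j).
  transitivity (\sum_(x < n) \sum_j B x * u x 0 j * seqcof u t j).
    apply: eq_bigr => x _; rewrite -[_ :: t]/([::] ++ nat_of_ord x :: t).
    rewrite seqdet_expand // expr0 mul1r mulr_sumr.
    by apply: eq_bigr => j _; rewrite mulrA.
  rewrite exchange_big; apply: eq_bigr => j _; rewrite -mulr_suml; congr (_ * _).
  by rewrite summxE; apply: eq_bigr => x _; rewrite mxE.
by rewrite Bu0; apply: big1 => j _; rewrite mxE mul0r.
Qed.

Lemma seqdet_row0 (K : fieldType) (m : nat) (u : nat -> 'rV[K]_m) s (i : 'I_m) :
  u (nth 0%N s i) = 0 -> seqdet u s = 0.
Proof.
move=> ui; rewrite /seqdet (expand_det_row _ i); apply: big1 => j _.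
by rewrite mxE ui mxE mul0r.
Qed.

Lemma eq_seqdet (K : fieldType) (m : nat) (u v : nat -> 'rV[K]_m) s t :
  (forall i : 'I_m, u (nth 0%N s i) = v (nth 0%N t i)) -> seqdet u s = seqdet v t.
Proof. by move=> uv; congr (\det _); apply/matrixP => i j; rewrite !mxE uv. Qed.

(** * Sorted lists of subsets and the sign of an insertion *)

Definition slist (N : nat) (X : {set 'I_N}) : seq nat :=
  [seq nat_of_ord x | x <- enum X].

Lemma size_slist (N : nat) (X : {set 'I_N}) : size (slist X) = #|X|.
Proof. by rewrite size_map -cardE. Qed.

Lemma mem_slist (N : nat) (X : {set 'I_N}) (x : 'I_N) :
  (nat_of_ord x \in slist X) = (x \in X).
Proof. by rewrite mem_map ?mem_enum //; apply: val_inj. Qed.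

Lemma sorted_slist (N : nat) (X : {set 'I_N}) : sorted ltn (slist X).
Proof.
rewrite sorted_map /enum_mem; apply: sorted_filter; first by move=> ? ? ?; apply: ltn_trans.
by rewrite -enumT -sorted_map -/(map _ _) val_enum_ord iota_ltn_sorted.
Qed.

(** The length of [s1] is the exponent in [eps], so [eps] is the sign of moving the row [s] to the
    front. *)
Lemma slistU1 (N : nat) (X : {set 'I_N}) (s : 'I_N) : s \notin X ->
  exists s1 s2, [/\ slist (s |: X) = s1 ++ nat_of_ord s :: s2, slist X = s1 ++ s2
    & size s1 = #|[set i in X | (i < s)%N]|].
Proof.
move=> sX; have := sorted_slist [set: 'I_N]; rewrite /slist.
(* All enumerations are filters of the full one, so cutting the full one at [s] cuts them all. *)
have eE (Y : {set 'I_N}) : enum Y = [seq x <- enum [set: 'I_N] | x \in Y].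
  rewrite {2}/enum_mem -filter_predI; apply: eq_filter => x /=.
  by rewrite inE andbT.
have s_in : s \in enum [set: 'I_N] by rewrite mem_enum inE.
have cE : #|[set i in X | (i < s)%N]| = size [seq x <- enum [set: 'I_N] | (x \in X) && (x < s)%N].
  rewrite cardE eE; congr size; apply: eq_filter => x; by rewrite inE.
rewrite cE (eE X) (eE (s |: X)).
case/splitPr: s_in => e1 e2.
rewrite sorted_map sorted_pairwise; last by move=> ? ? ?; apply: ltn_trans.
rewrite pairwise_cat allrel_consr /= => /and3P[/andP[/allP lt1 _] _ /andP[/allP lt2 _]].
exists [seq nat_of_ord x | x <- e1 & x \in X], [seq nat_of_ord x | x <- e2 & x \in X].
have f e : s \notin e -> [seq x <- e | x \in s |: X] = [seq x <- e | x \in X].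
  move=> se; apply: eq_in_filter => x xe; rewrite !inE.
  by case: eqP se => // <-; rewrite xe.
have s1 : s \notin e1 by apply/negP => /lt1; rewrite /= ltnn.
have s2 : s \notin e2 by apply/negP => /lt2; rewrite /= ltnn.
split.
- by rewrite !filter_cat /= !f // setU11 map_cat.
- by rewrite !filter_cat /= (negPf sX) map_cat.
rewrite filter_cat /= (negPf sX) /= size_cat size_map.
rewrite [X in (_ + size X)%N](_ : _ = [::]) ?addn0.
  by congr size; apply: eq_in_filter => x /lt1 /= ->; rewrite andbT.
apply/eqP; rewrite -size_eq0 size_filter -leqn0 leqNgt -has_count.
by apply/hasP => -[x /lt2 /= sx /andP[_]]; rewrite ltnNge (ltnW sx).
Qed.

(** * Pluecker vectors and one application of T *)

(** Recurrence coefficients reindexed from 0: index 0 carries beta_(-b) and index a+b carries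
    beta_a. *)
Definition wbeta (K : fieldType) (w : int -> K) (b x : nat) : K :=
  beta w (Posz x - Posz b).

Definition plrow (K : fieldType) (a b : nat) (u : nat -> 'rV[K]_a) : 'rV[K]_#|{: asub a b}| :=
  \row_i seqdet u (slist (val (enum_val i))).

Lemma asub_lt (a b : nat) (I : asub a b) (x : 'I_(a + b).+1) :
  x \in val I -> (x < a + b)%N.
Proof.
case/andP: (valP I) => _ nI xI; rewrite ltn_neqAle -ltnS ltn_ord andbT.
by apply: contra nI => /eqP xE; rewrite (_ : ord_max = x) //; apply: val_inj.
Qed.

Lemma card_asub (a b : nat) (I : asub a b) : #|val I| = a.
Proof. by case/andP: (valP I) => /eqP. Qed.

Lemma card_asubU (a b : nat) (I : asub a b) : #|val I :|: [set ord_max]| = a.+1.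
Proof.
by rewrite setUC cardsU1 card_asub; case/andP: (valP I) => _ ->.
Qed.

Lemma inord_asub (a b : nat) (I : asub a b) (x : 'I_(a + b).+1) :
  x \in val I -> (inord x.+1 : 'I_(a + b).+1) = x.+1 :> nat.
Proof. by move=> xI; rewrite inordK // ltnS (asub_lt xI). Qed.

Lemma card_shift1 (a b : nat) (J : asub a b) : #|shift1 (val J)| = a.
Proof.
rewrite card_in_imset ?card_asub // => x y xJ yJ /(congr1 (@nat_of_ord _)).
by rewrite !(@inord_asub _ _ J) // => -[/val_inj].
Qed.

Lemma slist_shift1 (a b : nat) (J : asub a b) :
  slist (shift1 (val J)) = [seq x.+1 | x <- slist (val J)].
Proof.
apply: (irr_sorted_eq ltn_trans ltnn); first exact: sorted_slist.
  by rewrite sorted_map; apply: (sub_sorted _ (sorted_slist _)) => x y.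
move=> x; apply/mapP/mapP => -[y].
  rewrite mem_enum => /imsetP[z zJ ->] ->; exists (nat_of_ord z).
    by rewrite mem_slist.
  by rewrite (inord_asub zJ).
case/mapP=> z; rewrite mem_enum => zJ -> ->; exists (inord z.+1).
  by rewrite mem_enum; apply/imsetP; exists z.
by rewrite (inord_asub zJ).
Qed.

(** A sum in place of a choice lets summations over s and I be exchanged. By cardinality s lies
    outside J+1, so at most one s occurs. *)
Lemma TentryE (K : fieldType) (w : int -> K) (a b : nat) (I J : asub a b) :
  Tentry w I J =
    \sum_(s : 'I_(a + b).+1 | val I :|: [set ord_max] == shift1 (val J) :|: [set s])
      eps K (val I) s * wbeta w b s.
Proof.
rewrite /Tentry; case: pickP => [s sP|noS]; last by rewrite big_pred0.
rewrite (big_pred1 s) // => r; apply/idP/eqP => [|-> //].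
have : s \notin shift1 (val J).
  apply/negP => sJ; have := card_asubU I; rewrite (eqP sP) setUC (setUidPr _) ?sub1set //.
  by rewrite card_shift1 => /eqP; rewrite ltn_eqF.
move=> sJ /eqP; rewrite (eqP sP) => /setP/(_ s).
by rewrite !inE eqxx orbT (negPf sJ) /= => /esym/eqP.
Qed.

Lemma asub_sum0 (K : fieldType) (a b : nat) (J : asub a b) (s : 'I_(a + b).+1)
    (F : asub a b -> K) : (s \in shift1 (val J)) || (ord_max \notin s |: shift1 (val J)) ->
  \sum_(I | val I :|: [set ord_max] == shift1 (val J) :|: [set s]) F I = 0.
Proof.
move=> sJ; apply: big_pred0 => I; apply/negP => /eqP IJ; case/orP: sJ => [sJ|/negP[]].
  have := card_asubU I; rewrite IJ setUC (setUidPr _) ?sub1set // card_shift1.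
  by move/eqP; rewrite ltn_eqF.
by rewrite setUC -IJ inE in_set1 eqxx orbT.
Qed.

(** For fixed J and s, the only candidate for I is (J+1) with s added and a removed. *)
Lemma asub_sum1 (K : fieldType) (a b : nat) (J : asub a b) (s : 'I_(a + b).+1)
    (F : {set 'I_(a + b).+1} -> K) :
  s \notin shift1 (val J) -> ord_max \in s |: shift1 (val J) ->
  \sum_(I : asub a b | val I :|: [set ord_max] == shift1 (val J) :|: [set s]) F (val I)
    = F ((s |: shift1 (val J)) :\ ord_max).
Proof.
move=> sJ nJ; have IP : is_asub a b ((s |: shift1 (val J)) :\ ord_max).
  rewrite /is_asub !inE eqxx andbT -(eqn_add2l 1); apply/eqP.
  have := cardsD1 ord_max (s |: shift1 (val J)); rewrite nJ => <-.
  by rewrite cardsU1 sJ card_shift1.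
rewrite (big_pred1 (exist (fun X => is_true (is_asub a b X)) _ IP : asub a b)) // => I.
rewrite setUC [X in _ == X]setUC.
apply/eqP/eqP => [E|->]; last by rewrite SubK; exact: setD1K.
by apply: val_inj; rewrite SubK -E setU1K //; case/andP: (valP I).
Qed.

(** Column J of T collects the sets I obtained from J+1 by adding some s and removing a. The signs
    turn this sum into the recurrence applied to one row of a determinant. *)
Lemma plrow_step (K : fieldType) (w : int -> K) (a b : nat) (u : nat -> 'rV[K]_a) :
  (0 < a)%N -> \sum_(x < (a + b).+1) wbeta w b x *: u x = 0 ->
  plrow b u *m Tmx w a b = ((-1) ^+ a * wbeta w b (a + b)) *: plrow b (fun y => u y.+1).
Proof.
case: a u => // a u _ Bu0; apply/rowP => j; rewrite !mxE.
set J := enum_val j.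
transitivity (\sum_(s : 'I_(a.+1 + b).+1) wbeta w b s *
   \sum_(I : asub a.+1 b | val I :|: [set ord_max] == shift1 (val J) :|: [set s])
     eps K (val I) s * seqdet u (slist (val I))).
  transitivity (\sum_(I : asub a.+1 b) seqdet u (slist (val I)) * Tentry w I J).
    by rewrite (big_enum_val (A := {: asub a.+1 b})); apply: eq_bigr => i _; rewrite !mxE.
  under eq_bigr do rewrite TentryE mulr_sumr.
  rewrite (exchange_big_dep predT) //=; apply: eq_bigr => s _.
  rewrite mulr_sumr; apply: eq_bigr => I _.
  by rewrite mulrC -mulrA mulrCA.
have -> : seqdet (fun y => u y.+1) (slist (val J)) = seqdet u (slist (shift1 (val J))).
  rewrite slist_shift1; apply: eq_seqdet => i.
  by rewrite (nth_map 0%N) // size_slist card_asub.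
have JC : forall X : {set 'I_(a.+1 + b).+1}, ord_max \notin X ->
    #|[set i in X | (i < (ord_max : 'I_(a.+1 + b).+1))%N]| = #|X|.
  move=> X nX; apply: eq_card => x; rewrite !inE; case xX: (x \in X) => //=.
  rewrite ltn_neqAle -ltnS ltn_ord andbT; apply: contraNneq nX => xE.
  by rewrite (_ : ord_max = x) //; apply: val_inj.
(* If a is not in J+1, only s = a contributes, with I = J+1 and sign (-1)^#|I|. *)
rewrite big_ord_recr /=; have [nJ|nJ] := boolP (ord_max \in shift1 (val J)); last first.
  rewrite big1 ?add0r => [|s _]; last first.
    rewrite asub_sum0 ?mulr0 // !inE (negPf nJ) orbF; apply/orP; right.
    by rewrite eq_sym -val_eqE /= ltn_eqF.
  have := @asub_sum1 K a.+1 b J ord_max (fun I => eps K I ord_max * seqdet u (slist I)) nJ.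
  rewrite setU11 => /(_ isT) ->; rewrite setU1K // /eps JC // card_shift1.
  by rewrite mulrA [in RHS](mulrC (_ ^+ _)).
(* If a is in J+1, the term s = a is empty. The other terms form the relation between the rows
   [x :: t] without its last summand, hence equal minus that summand. *)
rewrite (@asub_sum0 K a.+1 b J ord_max) ?nJ // mulr0 addr0.
set t := slist (shift1 (val J) :\ ord_max).
have szt : size t = a.
  apply/eqP; rewrite size_slist -(eqn_add2l 1).
  by have := cardsD1 ord_max (shift1 (val J)); rewrite nJ card_shift1 => <-.
have := seqdet_lin t Bu0; rewrite big_ord_recr /= => /eqP; rewrite addr_eq0 => /eqP lin.
have -> : seqdet u (slist (shift1 (val J))) = (-1) ^+ a * seqdet u ((a.+1 + b)%N :: t).
  have nJ' : ord_max \notin shift1 (val J) :\ ord_max by rewrite !inE eqxx.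
  have [s1 [s2 [e1 e2 e3]]] := slistU1 nJ'.
  rewrite -(setD1K nJ) e1 /t e2; have s1a : size s1 = a by rewrite e3 JC // -size_slist.
  by rewrite seqdet_move s1a.
transitivity (- (wbeta w b (a.+1 + b) * seqdet u ((a.+1 + b)%N :: t))); last first.
  by rewrite exprS mulN1r !mulNr [in RHS]mulrACA -expr2 sqrr_sign mul1r.
rewrite -lin; apply: eq_bigr => s _; congr (_ * _).
have sN : widen_ord (leqnSn (a.+1 + b)) s != ord_max :> 'I__.
  by rewrite -val_eqE /= ltn_eqF.
(* For s already in J+1 there is no I, and the determinant has a repeated row. *)
have [sJ|sJ] := boolP (widen_ord (leqnSn (a.+1 + b)) s \in shift1 (val J)).
  rewrite asub_sum0 ?sJ //; apply/esym/seqdet_dup => //.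
  by rewrite -[nat_of_ord s]/(nat_of_ord (widen_ord (leqnSn (a.+1 + b)) s)) mem_slist !inE sN.
set s' := widen_ord _ s in sN sJ *.
rewrite (@asub_sum1 K a.+1 b J s' (fun I => eps K I s' * seqdet u (slist I))) //; last first.
  by rewrite inE nJ orbT.
have -> : (s' |: shift1 (val J)) :\ ord_max = s' |: (shift1 (val J) :\ ord_max).
  by apply/setP => x; rewrite !inE; case: (eqVneq x s') => [->|] //=; rewrite sN.
have sJ' : s' \notin shift1 (val J) :\ ord_max by rewrite !inE (negPf sJ) andbF.
have [s1 [s2 [e1 e2 e3]]] := slistU1 sJ'.
have s1a : (size s1 <= a)%N by rewrite -szt /t e2 size_cat leq_addr.
rewrite e1 seqdet_move // -e2 mulrA /eps.
have -> : [set i in s' |: (shift1 (val J) :\ ord_max) | (i < s')%N]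
     = [set i in shift1 (val J) :\ ord_max | (i < s')%N].
  by apply/setP => x; rewrite !inE; case: (eqVneq x s') => [->|] //=; rewrite ltnn !andbF.
by rewrite -e3 -expr2 sqrr_sign mul1r.
Qed.

(** * Linear recurrences, extended forwards and backwards *)

Definition linrec (K : fieldType) (V : lmodType K) (B : nat -> K) (n : nat) (u : nat -> V) :=
  forall m, \sum_(x < n.+1) B x *: u (m + x)%N = 0.

Lemma linrec_init (K : fieldType) (V : lmodType K) (B : nat -> K) (n : nat) (f : nat -> V) :
  (0 < n)%N -> B n != 0 ->
  exists u, linrec B n u /\ forall x, (x < n)%N -> u x = f x.
Proof.
case: n => // n _ Bn.
(* [next] slides the window of places 0 to n one step along the recurrence; the solution reads the
   first place of each successive window. *)
pose next (g : nat -> V) y :=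
  if (y < n)%N then g y.+1 else - (B n.+1)^-1 *: \sum_(x < n.+1) B x *: g x.
have shift x : (x <= n)%N -> forall m, iter m next f x = iter (m + x) next f 0%N.
  elim: x => [|x IH] xn m; first by rewrite addn0.
  by rewrite addnS -addSn -IH ?(ltnW xn) //= /next xn.
exists (fun y => iter y next f 0%N); split=> [m|x xn]; last by rewrite -[x]add0n -shift.
rewrite big_ord_recr /= addnS -addSn -shift //.
have -> : iter m.+1 next f n = - (B n.+1)^-1 *: \sum_(x < n.+1) B x *: iter m next f x.
  by rewrite iterS /next ltnn.
rewrite scalerA mulrN divff // scaleN1r; apply/eqP; rewrite subr_eq0; apply/eqP.
by apply: eq_bigr => x _; rewrite (shift x (ltn_ord x)).
Qed.

(** Indices are natural numbers, so a backward step prepends the value forced by the recurrence and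
    moves the old terms up by one. *)
Definition linrec_back (K : fieldType) (V : lmodType K) (B : nat -> K) (n : nat)
    (u : nat -> V) (y : nat) : V :=
  if y is y'.+1 then u y' else - (B 0%N)^-1 *: \sum_(x < n) B x.+1 *: u x.

Lemma linrec_backP (K : fieldType) (V : lmodType K) (B : nat -> K) (n : nat) (u : nat -> V) :
  B 0%N != 0 -> linrec B n u -> linrec B n (linrec_back B n u).
Proof.
move=> B0 rec_u [|m]; last exact: rec_u.
by rewrite big_ord_recl /= scalerA mulrN divff // scaleN1r addNr.
Qed.

Lemma iter_linrec_backD (K : fieldType) (V : lmodType K) (B : nat -> K) (n k y : nat)
    (u : nat -> V) : iter k (linrec_back B n) u (k + y)%N = u y.
Proof. by elim: k => [|k IH] //; rewrite addSn. Qed.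

Lemma iter_linrec_backP (K : fieldType) (V : lmodType K) (B : nat -> K) (n k : nat)
    (u : nat -> V) :
  B 0%N != 0 -> linrec B n u -> linrec B n (iter k (linrec_back B n) u).
Proof. by move=> B0 rec_u; elim: k => //= k IH; apply: linrec_backP. Qed.

Lemma linrec_eq0 (K : fieldType) (V : lmodType K) (B : nat -> K) (n : nat) (u : nat -> V) :
  B n != 0 -> linrec B n u -> (forall x, (x < n)%N -> u x = 0) -> forall x, u x = 0.
Proof.
move=> Bn rec_u u0; elim/ltn_ind => x IH; case: (ltnP x n) => [/u0 //|nx].
have := rec_u (x - n)%N; rewrite big_ord_recr /= subnK // big1 => [|y _].
  by move/eqP; rewrite add0r scaler_eq0 (negPf Bn) => /eqP.
by rewrite IH ?scaler0 // -ltn_subRL subKn.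
Qed.

(** * F_k as a minor of the solution space *)

(** The last of the k unit columns has its only 1 in the last row; expanding along it contributes
    (-1)^a and lowers k by one. *)
Lemma det_delta_id_block (K : fieldType) (a k : nat) (V : nat -> nat -> K) :
  (forall i j, (i < a)%N -> (j < a)%N -> V i j = (i == j)%:R) ->
  \det (\matrix_(i < k + a, j < k + a)
     (if (j < k)%N then (i == a + j :> nat)%N%:R else V i (j - k)%N)) = (-1) ^+ (a * k).
Proof.
move=> Vid; elim: k => [|k IH].
  rewrite muln0 -[RHS](det1 K (0 + a)); congr (\det _); apply/matrixP => i j.
  by rewrite !mxE /= subn0 Vid.
have kn : (k < k.+1 + a)%N by rewrite addSn ltnS leq_addr.
rewrite (expand_det_col _ (Ordinal kn)) (bigD1 (ord_max : 'I_(k + a).+1)) //=.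
rewrite big1 ?addr0 => [|i iN]; last first.
  rewrite mxE /= ltnSn (_ : _ == _ = false) ?mul0r //.
  by apply: contraNF iN => /eqP iE; apply/eqP/val_inj; rewrite /= iE addnC.
rewrite mxE /= ltnSn [(a + k)%N]addnC eqxx mul1r /cofactor /= (_ : (-1) ^+ (k + a + k) = (-1) ^+ a); last first.
  by rewrite addnAC addnn exprD -mul2n exprM sqrrN !expr1n mul1r.
rewrite mulnS exprD; congr (_ * _); rewrite -IH; congr (\det _); apply/matrixP => i j.
rewrite !mxE /= /bump (leqNgt (k + a)) ltn_ord add0n; case: (leqP k j) => [kj|jk].
  by rewrite add1n !ltnS ltnNge kj subSS.
by rewrite add0n (leqW jk).
Qed.

Lemma beta_eq0 (K : fieldType) (w : int -> K) (a b : nat) (s : int) :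
  (0 < a)%N -> (0 < b)%N -> (forall s, ~~ (- Posz b <= s <= Posz a) -> w s = 0) ->
  ~~ (- Posz b <= s <= Posz a) -> beta w s = 0.
Proof.
move=> a0 b0 w0 sN; rewrite /beta w0 // subr0; case: eqP sN => // ->.
by rewrite oppr_le0 !lez_nat.
Qed.

(** The columns of [U] lie in the kernel of the band matrix [R], whose first k columns form 1 -
    A_(k-1). [X] selects the last k columns of [R], which form a triangular block with diagonal
    beta_a. *)
Lemma Fk_seqdet (K : fieldType) (w : int -> K) (a b k : nat) (u : nat -> 'rV[K]_a) :
  (0 < a)%N -> (0 < b)%N -> (forall s, ~~ (- Posz b <= s <= Posz a) -> w s = 0) ->
  linrec (wbeta w b) (a + b) u -> (forall x, (x < b)%N -> u x = 0) ->
  (forall j : 'I_a, u (b + j)%N = delta_mx 0 j) ->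
  Fk w k = ((-1) ^+ a * wbeta w b (a + b)) ^+ k *
    \det (\matrix_(i < a, j < a) u (k + (b + i))%N 0 j).
Proof.
move=> a0 b0 w0 rec_u u0 uid.
pose R1 := \matrix_(i < k, j < k) beta w (Posz j - Posz i).
pose R := \matrix_(i < k, j < k + a) beta w (Posz j - Posz i).
have -> : Fk w k = \det R1.
  case: k @R1 @R => [|k] R1 R; first by rewrite /= det_mx00.
  congr (\det _); apply/matrixP => i j; rewrite !mxE /beta subr_eq0 eqz_nat.
  by rewrite eq_sym.
pose X := \matrix_(i < k + a, j < k) ((i == a + j :> nat)%N%:R : K).
pose U := \matrix_(i < k + a, j < a) u (b + i)%N 0 j.
have detM : \det (row_mx X U) = (-1) ^+ (a * k).
  (* [insub] extends the entries of [U] to all natural column indices, with default 0. *)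
  pose V i j := if insub j is Some j' then u (b + i)%N 0 (j' : 'I_a) else 0.
  rewrite -(@det_delta_id_block K a k V) => [|i j ia ja]; last first.
    rewrite /V insubT -[i]/(nat_of_ord (Ordinal ia)) uid mxE eqxx /= -val_eqE /=.
    by rewrite eq_sym.
  congr (\det _); apply/matrixP => i j; rewrite !mxE.
  case: splitP => j' jE; rewrite mxE jE ?ltn_ord //.
  by rewrite addKn /V valK.
(* The b initial zeros of [u] extend the sum to the left; cutting it to the band from i to i+a+b
   then leaves the recurrence at i. *)
have RU : R *m U = 0.
  apply/matrixP => i j; rewrite !mxE.
  under eq_bigr do rewrite !mxE.
  rewrite -(big_mkord xpredT (fun y => beta w (Posz y - Posz i) * u (b + y)%N 0 j)).
  have := rec_u i => /matrixP/(_ 0 j); rewrite summxE mxE => rec_i.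
  transitivity (\sum_(0 <= z < b + (k + a)) beta w (Posz z - Posz b - Posz i) * u z 0 j).
    rewrite [RHS](big_cat_nat (n := b)) ?leq_addr //=.
    rewrite [X in _ = X + _]big_nat [X in _ = X + _]big1 ?add0r => [|z /andP[_ zb]].
      rewrite -{2}[b]add0n big_addn addKn; apply: eq_bigr => y _.
      by rewrite [(y + b)%N]addnC PoszD [Posz b + _]addrC addrK.
    by rewrite u0 // mxE mulr0.
  have i1 : (i + (a + b).+1 <= b + (k + a))%N.
    by rewrite addnS -addSn [(a + b)%N]addnC addnCA leq_add2l leq_add2r.
  rewrite (big_cat_nat (n := i)) ?(leq_trans (leq_addr _ _) i1) //=.
  rewrite big_nat big1 ?add0r => [|z /andP[_ zi]]; last first.
    rewrite (beta_eq0 a0 b0 w0) ?mul0r // negb_and; apply/orP; left.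
    by rewrite -ltNge addrAC ltrBlDr addNr subr_lt0 ltz_nat.
  rewrite (big_cat_nat (n := (i + (a + b).+1)%N)) ?leq_addr //=.
  rewrite [X in _ + X]big_nat [X in _ + X]big1 ?addr0 => [|z /andP[zi _]]; last first.
    rewrite (beta_eq0 a0 b0 w0) ?mul0r // negb_and; apply/orP; right.
    rewrite -ltNge -addrA -opprD ltrBrDr -PoszD ltz_nat.
    by rewrite [(b + i)%N]addnC addnCA -addnS.
  rewrite -{1}[val i]add0n big_addn addKn -[RHS]rec_i big_mkord; apply: eq_bigr => x _.
  by rewrite !mxE /wbeta PoszD addrAC addrK [(x + _)%N]addnC.
have RX : \det (R *m X) = wbeta w b (a + b) ^+ k.
  have RXE i j : (R *m X) i j = beta w (Posz (a + j) - Posz i).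
    have aj : (a + j < k + a)%N by rewrite addnC ltn_add2r.
    rewrite mxE (bigD1 (Ordinal aj)) //= big1 => [|y yN]; last first.
      rewrite !mxE (_ : _ == _ = false) ?mulr0 //.
      by apply: contraNF yN => /eqP yE; apply/eqP/val_inj.
    by rewrite !mxE /= eqxx mulr1 addr0.
  rewrite det_trig => [|]; last first.
    apply/is_trig_mxP => i j ij; rewrite RXE (beta_eq0 a0 b0 w0) // negb_and.
    by apply/orP; right; rewrite -ltNge ltrBrDr -PoszD ltz_nat ltn_add2l.
  rewrite (eq_bigr (fun _ => wbeta w b (a + b))) ?prodr_const ?card_ord // => i _.
  by rewrite RXE /wbeta !PoszD !addrK.
(* det (G *m row_mx X U) is computed both as a product and from its block
   triangular form. *)
pose G := col_mx R (row_mx 0 (1%:M : 'M_a)).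
have detG : \det G = \det R1.
  rewrite /G -[R]hsubmxK -/(block_mx _ _ _ _) det_ublock det1 mulr1.
  by congr (\det _); apply/matrixP => i j; rewrite !mxE.
have : \det (G *m row_mx X U) = \det R1 * (-1) ^+ (a * k) by rewrite det_mulmx detG detM.
rewrite /G mul_col_row RU det_lblock RX => E.
have -> : \det R1 = \det R1 * (-1) ^+ (a * k) * (-1) ^+ (a * k).
  by rewrite -mulrA -expr2 sqrr_sign mulr1.
rewrite -E exprMn -exprM [LHS]mulrC mulrA; congr (_ * \det _).
rewrite -[X in row_mx 0 1%:M *m X]vsubmxK mul_row_col mul0mx add0r mul1mx.
by apply/matrixP => i j; rewrite !mxE /= addnCA.
Qed.

(** * Powers of T, its invertibility, and the basis vector of I_0 *)

Lemma plrow_iter (K : fieldType) (w : int -> K) (a b k : nat) (u : nat -> 'rV[K]_a) :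
  (0 < a)%N -> linrec (wbeta w b) (a + b) u ->
  iter k (fun v => v *m Tmx w a b) (plrow b u) =
    ((-1) ^+ a * wbeta w b (a + b)) ^+ k *: plrow b (fun y => u (k + y)%N).
Proof.
move=> a0 rec_u; elim: k => [|k IH]; first by rewrite expr0 scale1r.
rewrite iterS IH -scalemxAl (plrow_step a0 (rec_u k)) scalerA -exprSr.
by congr (_ *: _); apply/rowP => i; rewrite !mxE; apply: eq_seqdet => j; rewrite addnS.
Qed.

(** The rows in I form the identity; any other a-subset contains an index outside I, hence a zero
    row. *)
Lemma plrow_delta (K : fieldType) (a b : nat) (u : nat -> 'rV[K]_a) (I : asub a b) :
  (forall i : 'I_a, u (nth 0%N (slist (val I)) i) = delta_mx 0 i) ->
  (forall x, (x < a + b)%N -> x \notin slist (val I) -> u x = 0) ->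
  plrow b u = delta_mx 0 (enum_rank I).
Proof.
move=> uI u0; apply/rowP => i; rewrite !mxE /=; case: eqP => [->|iI] /=.
  rewrite enum_rankK -[RHS](det1 K a); congr (\det _); apply/matrixP => r s.
  by rewrite mxE uI !mxE eqxx eq_sym.
have [x xi xI] : exists2 x, x \in val (enum_val i) & x \notin val I.
  apply/subsetPn; apply: contra_notN iI => sub; apply/esym.
  rewrite -[RHS]enum_valK; congr enum_rank; apply/val_inj/esym/eqP.
  by rewrite eqEcard sub !card_asub leqnn.
have idx : (index (nat_of_ord x) (slist (val (enum_val i))) < a)%N.
  by move: xi; rewrite -mem_slist -index_mem size_slist card_asub.
apply: (@seqdet_row0 _ _ _ _ (Ordinal idx)) => /=.
by rewrite nth_index ?mem_slist // u0 ?mem_slist // (asub_lt xi).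
Qed.

Lemma Tmx_unit (K : fieldType) (w : int -> K) (a b : nat) :
  (0 < a)%N -> wbeta w b 0 != 0 -> wbeta w b (a + b) != 0 -> Tmx w a b \in unitmx.
Proof.
(* It suffices that each basis vector lies in the row space of T: it is the Pluecker vector of a
   solution, and one backward step gives a preimage up to the factor c. *)
move=> a0 B0 Bn; rewrite -row_full_unit -sub1mx; apply/row_subP => i; rewrite row1.
set s := slist (val (enum_val i)).
pose f x : 'rV[K]_a := \row_j ((x \in s) && (index x s == j))%:R.
have [|u [rec_u uf]] := linrec_init f _ Bn; first by rewrite addn_gt0 a0.
have sza : size s = a by rewrite size_slist card_asub.
have s_uniq : uniq s by apply: (sorted_uniq ltn_trans ltnn (sorted_slist _)).
have s_lt x : x \in s -> (x < a + b)%N.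
  by case/mapP=> y; rewrite mem_enum => /asub_lt ylt ->.
have -> : delta_mx 0 i = plrow b u.
  rewrite (@plrow_delta _ _ _ _ (enum_val i)) ?enum_valK // => [j|x xn xs].
    have js : nth 0%N s j \in s by rewrite mem_nth ?sza.
    rewrite uf ?s_lt //; apply/rowP => k.
    rewrite /f mxE js.
    rewrite (index_uniq 0%N _ s_uniq) ?sza //.
    by rewrite mxE /= eq_sym.
  by rewrite uf //; apply/rowP => k; rewrite !mxE (negPf xs).
have cn0 : (-1) ^+ a * wbeta w b (a + b) != 0 by rewrite mulf_neq0 // signr_eq0.
have := plrow_step (b := b) a0 (linrec_backP B0 rec_u 0%N).
move/(congr1 (fun v => ((-1) ^+ a * wbeta w b (a + b))^-1 *: v)).
rewrite scalerA mulVf // scale1r scalemxAl => E.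
rewrite (_ : plrow b u = plrow b (fun y => linrec_back (wbeta w b) (a + b) u y.+1)) //.
by rewrite -E submxMl.
Qed.

Lemma slist_I0 (a b : nat) : slist (I0set a b) = iota b a.
Proof.
apply: (irr_sorted_eq ltn_trans ltnn); first exact: sorted_slist.
  exact: iota_ltn_sorted.
move=> x; rewrite mem_iota [(b + a)%N]addnC; apply/mapP/idP => [[y]|xab].
  by rewrite mem_enum inE => yab ->.
have xn : (x < (a + b).+1)%N by case/andP: xab => _ /ltnW.
by exists (Ordinal xn) => //; rewrite mem_enum inE.
Qed.

Lemma plrow_I0 (K : fieldType) (a b : nat) (u : nat -> 'rV[K]_a) :
  plrow b u 0 (enum_rank (I0 a b)) = \det (\matrix_(i < a, j < a) u (b + i)%N 0 j).
Proof.
rewrite mxE enum_rankK slist_I0; congr (\det _); apply/matrixP => i j.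
by rewrite !mxE nth_iota.
Qed.

Lemma linrec_I0 (K : fieldType) (B : nat -> K) (a b : nat) :
  (0 < a)%N -> B (a + b)%N != 0 ->
  exists u : nat -> 'rV[K]_a, [/\ linrec B (a + b) u, forall x, (x < b)%N -> u x = 0,
    forall j : 'I_a, u (b + j)%N = delta_mx 0 j
    & plrow b u = delta_mx 0 (enum_rank (I0 a b))].
Proof.
move=> a0 Bn; pose f x : 'rV[K]_a := \row_j (x == b + j)%:R.
have [|u [rec_u uf]] := linrec_init f _ Bn; first by rewrite addn_gt0 a0.
have u0 x : (x < b)%N -> u x = 0.
  move=> xb; rewrite uf ?ltn_addl //; apply/rowP => j; rewrite !mxE ltn_eqF //.
  exact: ltn_addr.
have u1 (j : 'I_a) : u (b + j)%N = delta_mx 0 j.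
  rewrite uf; last by rewrite addnC ltn_add2r.
  by apply/rowP => k; rewrite !mxE eqn_add2l eq_sym.
exists u; split=> //; apply: plrow_delta => [i|x xn]; rewrite slist_I0 ?nth_iota ?u1 //.
rewrite mem_iota [(b + a)%N]addnC xn andbT -ltnNge; exact: u0.
Qed.

(** * Powers of the inverse of T as minors of backward extensions *)

Lemma iter_mulmxK (K : fieldType) (m k : nat) (T : 'M[K]_m) (v : 'rV[K]_m) :
  T \in unitmx ->
  iter k (fun v => v *m invmx T) (iter k (fun v => v *m T) v) = v.
Proof.
move=> uT; elim: k v => // k IH v; rewrite iterS iterSr IH mulmxK //.
Qed.

(** Applying T k times to the Pluecker vector of the extension gives c^k times that of [u]. Only
    vanishing is compared, so the nonzero c^k drops out. *)
Lemma iter_invT_I0 (K : fieldType) (w : int -> K) (a b k : nat) (u : nat -> 'rV[K]_a) :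
  (0 < a)%N -> wbeta w b 0 != 0 -> wbeta w b (a + b) != 0 ->
  linrec (wbeta w b) (a + b) u ->
  (iter k (fun v => v *m invmx (Tmx w a b)) (plrow b u) 0 (enum_rank (I0 a b)) == 0) =
  (\det (\matrix_(i < a, j < a)
     iter k (linrec_back (wbeta w b) (a + b)) u (b + i)%N 0 j) == 0).
Proof.
move=> a0 B0 Bn rec_u; set v := iter k (linrec_back _ _) u.
have cn0 : ((-1) ^+ a * wbeta w b (a + b)) ^+ k != 0.
  by rewrite expf_neq0 // mulf_neq0 // signr_eq0.
have := plrow_iter (b := b) k a0 (iter_linrec_backP k B0 rec_u); rewrite -/v.
rewrite (_ : plrow b (fun y => v (k + y)%N) = plrow b u); last first.
  apply/rowP => i; rewrite !mxE; apply: eq_seqdet => j; exact: iter_linrec_backD.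
move/(congr1 (fun x => ((-1) ^+ a * wbeta w b (a + b)) ^- k *: x)).
rewrite scalerA mulVf // scale1r => <-.
have iterZ l c x : iter l (fun v => v *m invmx (Tmx w a b)) (c *: x) =
    c *: iter l (fun v => v *m invmx (Tmx w a b)) x.
  by elim: l => //= l ->; rewrite scalemxAl.
rewrite iterZ iter_mulmxK ?Tmx_unit // mxE mulf_eq0 invr_eq0 (negPf cn0) /=.
by rewrite plrow_I0.
Qed.

Lemma back_det_eq0 (K : fieldType) (B : nat -> K) (a b k : nat) (u : nat -> 'rV[K]_a) :
  (0 < a)%N -> (0 < b)%N -> (forall x, (x < b)%N -> u x = 0) -> (0 < k < a + b)%N ->
  \det (\matrix_(i < a, j < a) iter k (linrec_back B (a + b)) u (b + i)%N 0 j) = 0.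
Proof.
move=> a0 b0 u0 /andP[k0 kn].
(* The zeros of [u] now sit at k, .., k+b-1. Index max(k, b) is one of them and lies in the window
   b, .., b+a-1, as its row k-b (truncated). *)
have ia : (k - b < a)%N by lia.
rewrite (expand_det_row _ (Ordinal ia)) big1 // => j _; rewrite mxE /=.
rewrite -maxnE [X in iter _ _ _ X](_ : _ = k + (b - k))%N; last by rewrite -maxnE maxnC.
by rewrite iter_linrec_backD u0 ?mxE ?mul0r //; lia.
Qed.

Lemma back_det_neq0 (K : fieldType) (B : nat -> K) (a b : nat) (u : nat -> 'rV[K]_a) :
  (0 < a)%N -> B 0%N != 0 -> B (a + b)%N != 0 -> linrec B (a + b) u ->
  (forall x, (x < b)%N -> u x = 0) -> (forall j : 'I_a, u (b + j)%N = delta_mx 0 j) ->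
  \det (\matrix_(i < a, j < a) iter (a + b) (linrec_back B (a + b)) u (b + i)%N 0 j) != 0.
Proof.
move=> a0 B0 Bn rec_u u0 u1; set v := iter _ _ u.
rewrite -det_tr; apply/det0P => -[x xn0 /rowP xv].
have rec_v : linrec B (a + b) v by apply: iter_linrec_backP.
(* A kernel vector [x] pairs with [v] to a scalar solution: it vanishes at k < a by the choice of
   [x], at the next b places by the zeros of [u], and equals the coordinates of [x] from a+b on. *)
pose y k : 'M[K]_1 := v (b + k)%N *m x^T.
have rec_y : linrec B (a + b) y.
  move=> m; under eq_bigr do rewrite /y scalemxAl.
  by rewrite -mulmx_suml; under eq_bigr do rewrite addnA; rewrite rec_v mul0mx.
have y0 k : (k < a + b)%N -> y k = 0.
  move=> kn; have [ka|ak] := ltnP k a.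
    apply/matrixP => i j; rewrite !ord1; have := xv (Ordinal ka); rewrite !mxE => E.
    by rewrite -[RHS]E; apply: eq_bigr => l _; rewrite !mxE /= mulrC.
  rewrite /y (_ : b + k = a + b + (k - a))%N; last by lia.
  by rewrite /v iter_linrec_backD u0 ?mul0mx //; lia.
case/eqP: xn0; apply/rowP => j.
have := linrec_eq0 Bn rec_y y0 (a + b + j)%N; rewrite /y addnCA /v iter_linrec_backD u1.
by rewrite -rowE => /matrixP/(_ 0 0); rewrite !mxE.
Qed.

(** * Coefficients of the adjugate of 1 - zT, from both ends *)

Definition resolvent_mx (K : fieldType) (m : nat) (T : 'M[K]_m) : 'M[{poly K}]_m :=
  1%:M - 'X *: map_mx polyC T.

Definition adj_coef (K : fieldType) (m : nat) (T : 'M[K]_m) (i0 : 'I_m) (k : nat) : 'rV[K]_m :=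
  \row_j (\adj (resolvent_mx T) i0 j)`_k.

(** Coefficient of z^k in row [i0] of adj(1-zT) (1-zT) = D. *)
Lemma adj_coef_rec (K : fieldType) (m : nat) (T : 'M[K]_m) (i0 : 'I_m) (k : nat) :
  adj_coef T i0 k = (if k is k'.+1 then adj_coef T i0 k' *m T else 0)
    + (\det (resolvent_mx T))`_k *: delta_mx 0 i0.
Proof.
apply/rowP => j; have := mul_adj_mx (resolvent_mx T) => /matrixP/(_ i0 j).
rewrite {2}/resolvent_mx mulmxBr mulmx1 -scalemxAr !mxE => /(canRL (subrK _)) ->.
rewrite [RHS]addrC coefD coefXM; congr (_ + _).
  by rewrite coefMn /= eq_sym; case: eqP; rewrite ?mulr1 ?mulr0 ?mulr1n ?mulr0n.
case: k => [|k]; first by rewrite [RHS]mxE.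
rewrite /= coef_sum [RHS]mxE; apply: eq_bigr => l _.
by rewrite !mxE coefMC.
Qed.

Lemma adj_coefE (K : fieldType) (m : nat) (T : 'M[K]_m) (i0 : 'I_m) (k : nat) :
  adj_coef T i0 k = \sum_(i < k.+1)
    (\det (resolvent_mx T))`_i *: iter (k - i) (fun v : 'rV_m => v *m T) (delta_mx 0 i0).
Proof.
elim: k => [|k IH]; rewrite adj_coef_rec big_ord_recr /= ?subnn /=.
  by rewrite big_ord0.
congr (_ + _); rewrite IH mulmx_suml; apply: eq_bigr => i _.
by rewrite -scalemxAl subSn // -ltnS.
Qed.

Lemma adj_coef_cofactor (K : fieldType) (m : nat) (T : 'M[K]_m) (i0 : 'I_m) (k : nat) :
  adj_coef T i0 k 0 i0 = (\det (row' i0 (col' i0 (resolvent_mx T))))`_k.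
Proof. by rewrite !mxE /cofactor addnn -mul2n exprM sqrrN !expr1n mul1r. Qed.

(** Factorization 1 - zT = -T (z - T^-1). *)
Lemma det_resolvent_unit (K : fieldType) (m : nat) (T : 'M[K]_m) :
  T \in unitmx -> \det (resolvent_mx T) = (\det (- T))%:P * char_poly (invmx T).
Proof.
move=> uT; rewrite /char_poly -det_map_mx -det_mulmx; congr (\det _).
rewrite /char_poly_mx mulmxBr mul_mx_scalar -map_mxM mulNmx mulmxV // !map_mxN.
by rewrite map_mx1 opprK scalerN addrC.
Qed.

Lemma size_det_resolvent (K : fieldType) (m : nat) (T : 'M[K]_m) :
  T \in unitmx -> size (\det (resolvent_mx T)) = m.+1.
Proof.
move=> uT; rewrite det_resolvent_unit // size_Cmul ?size_char_poly //.
by rewrite -scaleN1r detZ mulf_neq0 ?signr_eq0 // -unitfE -unitmxE.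
Qed.

Lemma adj_coef_prev (K : fieldType) (m : nat) (T : 'M[K]_m) (i0 : 'I_m) (k : nat) :
  T \in unitmx -> adj_coef T i0 k =
    (adj_coef T i0 k.+1 - (\det (resolvent_mx T))`_k.+1 *: delta_mx 0 i0) *m invmx T.
Proof. by move=> uT; rewrite (adj_coef_rec _ _ k.+1) addrK mulmxK. Qed.

Lemma adj_coef_eq0 (K : fieldType) (m : nat) (T : 'M[K]_m) (i0 : 'I_m) (k : nat) :
  T \in unitmx -> (m <= k)%N -> adj_coef T i0 k = 0.
Proof.
(* [L] bounds the sizes of the row's entries, so coefficients vanish from [L] on. Since D has degree
   m, the backward recursion carries the vanishing down to m. *)
move=> uT; pose L := \max_j size (\adj (resolvent_mx T) i0 j).
have : (L - k <= L)%N by rewrite leq_subr.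
move: {2}(L - k)%N (leqnn (L - k)) => d; elim: d k => [|d IH] k Lk dL mk.
  apply/rowP => l; rewrite [LHS]mxE [RHS]mxE nth_default //.
  have sL : (size (\adj (resolvent_mx T) i0 l) <= L)%N.
    exact: (leq_bigmax (F := fun j => size (\adj (resolvent_mx T) i0 j)) l).
  by apply: leq_trans sL _; lia.
rewrite adj_coef_prev // IH; try lia.
by rewrite sub0r nth_default ?scale0r ?oppr0 ?mul0mx // size_det_resolvent.
Qed.

(** Expansion at infinity: the recursion is run downwards from the zero coefficient at m. *)
Lemma adj_coef_inv (K : fieldType) (m : nat) (T : 'M[K]_m) (i0 : 'I_m) (j : nat) :
  T \in unitmx -> (j <= m)%N ->
  adj_coef T i0 (m - j) = - \sum_(i < j) (\det (resolvent_mx T))`_(m - i) *: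
    iter (j - i) (fun v : 'rV_m => v *m invmx T) (delta_mx 0 i0).
Proof.
move=> uT; elim: j => [|j IH] jm; last first.
  rewrite adj_coef_prev // subnSK // IH ?(ltnW jm) // mulmxBl mulNmx -opprD; congr (- _).
  rewrite big_ord_recr /= subSn // subnn /= -scalemxAl; congr (_ + _).
  rewrite mulmx_suml; apply: eq_bigr => i _.
  by rewrite -scalemxAl subSn // ltnW.
by rewrite big_ord0 oppr0 subn0 adj_coef_eq0.
Qed.

Lemma size_cofactor_resolvent (K : fieldType) (m r : nat) (T : 'M[K]_m) (i0 : 'I_m) :
  T \in unitmx -> (0 < r <= m)%N ->
  (forall k, (0 < k < r)%N -> iter k (fun v : 'rV_m => v *m invmx T) (delta_mx 0 i0) 0 i0 = 0) ->
  iter r (fun v : 'rV_m => v *m invmx T) (delta_mx 0 i0) 0 i0 != 0 ->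
  size (\det (row' i0 (col' i0 (resolvent_mx T)))) = (m - r).+1.
Proof.
move=> uT /andP[r0 rm] q0 qr; set N := \det _.
have NE j : (j <= m)%N -> N`_(m - j) = - \sum_(i < j) (\det (resolvent_mx T))`_(m - i) *
    iter (j - i) (fun v : 'rV_m => v *m invmx T) (delta_mx 0 i0) 0 i0.
  move=> jm; rewrite -adj_coef_cofactor adj_coef_inv // mxE summxE.
  by congr (- _); apply: eq_bigr => i _; rewrite mxE.
have Dm : (\det (resolvent_mx T))`_m != 0.
  have := lead_coef_eq0 (\det (resolvent_mx T)).
  by rewrite lead_coefE -size_poly_eq0 size_det_resolvent // => ->.
(* Only i = 0 survives, giving minus the leading coefficient of D times the diagonal entry of
   T^-r. *)
have Nr : N`_(m - r) != 0.
  rewrite NE // oppr_eq0; case: r r0 rm q0 qr => // r _ rm q0 qr.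
  rewrite big_ord_recl /= !subn0 big1 ?addr0 ?mulf_neq0 // => i _.
  by rewrite q0 ?mulr0 //= /bump; have := ltn_ord i; lia.
apply/eqP; rewrite eqn_leq; apply/andP; split; last first.
  by rewrite ltnNge; apply: contra Nr => le; rewrite nth_default.
apply/leq_sizeP => k mrk; have [mk|km] := leqP m k.
  by rewrite -adj_coef_cofactor adj_coef_eq0 ?mxE.
rewrite -(subKn (ltnW km)) NE ?leq_subr // big1 ?oppr0 // => i _.
by rewrite q0 ?mulr0 //; have := ltn_ord i; lia.
Qed.

(** * Size of T and conclusion *)

Lemma card_asubs (a b : nat) : #|{: asub a b}| = 'C(a + b, a).
Proof.
rewrite card_sub -[in RHS](card_ord (a + b)%N) -[X in 'C(X, _)]/(#|'I_(a + b)|).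
have -> : #|'I_(a + b)| = #|[set~ (ord_max : 'I_(a + b).+1)]| by rewrite cardsC1 !card_ord.
rewrite -cards_draws -[RHS]cardsE; apply: eq_card => X.
by rewrite !inE /is_asub /= andbC subsetC sub1set inE.
Qed.

(** Ensures that the subtraction in the degree of N is not truncated. *)
Lemma leq_add_bin (a b : nat) : (0 < a)%N -> (0 < b)%N -> (a + b <= 'C(a + b, a))%N.
Proof.
case: a => // a _; elim: b => // b IH _; rewrite addnS binS; case: b IH => [|b] IH.
  by rewrite addn0 binn binSn; lia.
have := IH isT; have : (0 < 'C(a.+1 + b.+1, a))%N by rewrite bin_gt0; lia.
lia.
Qed.

Theorem mainTheorem5 (K : fieldType) (charK : [pchar K] =i pred0)
  (S : seq int) (a b : nat) (w : int -> K)
  (a_ge1 : (1 <= a)%N) (b_ge1 : (1 <= b)%N)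
  (a_in : Posz a \in S) (mb_in : - Posz b \in S)
  (S_range : forall s, s \in S -> - Posz b <= s <= Posz a)
  (w_out : forall s, s \notin S -> w s = 0)
  (wa_nz : w (Posz a) != 0) (wb_nz : w (- Posz b) != 0) :
  (forall n : nat,
     \sum_(i < n.+1) (Dpoly w a b)`_i * Fk w (n - i) = (Npoly w a b)`_n)
  /\ size (Dpoly w a b) = ('C(a + b, a)).+1
  /\ size (Npoly w a b) = ('C(a + b, a) - (a + b)).+1.
Proof.
have w0 s : ~~ (- Posz b <= s <= Posz a) -> w s = 0.
  by move=> sN; apply: w_out; apply: contra sN; apply: S_range.
have B0 : wbeta w b 0 != 0.
  rewrite /wbeta sub0r /beta oppr_eq0 eqz_nat (_ : (b == 0)%N = false) ?sub0r ?oppr_eq0 //.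
  by rewrite eqn0Ngt b_ge1.
have Bn : wbeta w b (a + b) != 0.
  rewrite /wbeta PoszD addrK /beta eqz_nat (_ : (a == 0)%N = false) ?sub0r ?oppr_eq0 //.
  by rewrite eqn0Ngt a_ge1.
have [u [rec_u u0 u1 uE]] := linrec_I0 a_ge1 Bn.
have uT := Tmx_unit a_ge1 B0 Bn.
split; [|split].
- move=> n; rewrite /Npoly -[Mz w a b]/(resolvent_mx (Tmx w a b)).
  rewrite -adj_coef_cofactor adj_coefE summxE; apply: eq_bigr => i _.
  (* The basis vector of I_0 is the Pluecker vector of [u], so the entry of T^(n-i) at I_0 is a
     power of c times a window minor, which is F_(n-i). *)
  rewrite mxE -uE plrow_iter // mxE plrow_I0; congr (_ * _).
  exact: Fk_seqdet.
- by rewrite [LHS](size_det_resolvent uT) card_asubs.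
rewrite -card_asubs; apply: size_cofactor_resolvent => //.
- by rewrite addn_gt0 a_ge1 card_asubs leq_add_bin.
- move=> k kab; apply/eqP; rewrite -uE iter_invT_I0 //.
  by rewrite back_det_eq0.
by rewrite -uE iter_invT_I0 // back_det_neq0.
Qed.
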